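(* Let $\ell>0$ and, for $k=0,1,2,\ldots$, let $\varphi_k(x)=\lambda_k\,x(\ell-x)\,\hat P_k^{(1,1)}(x)$ with $\lambda_k=\frac{1}{\ell^3}\frac{(k+2)(2k+3)}{k+1}$, where $\hat P_k^{(a,b)}(x):=P_k^{(a,b)}\left(\frac{2x}{\ell}-1\right)$ and $P_k^{(a,b)}$ denotes the Jacobi polynomial. Let $\psi_k^{\sigma+}(x):={}_{0}^{R}D_{x}^{\sigma}\varphi_k(x)$ be the left-sided Riemann--Liouville fractional derivative of order $\sigma$ of $\varphi_k$. Then, for all $x\in(0,\ell)$: (i) If $0<\sigma<1$ or $1<\sigma<2$, then $$\psi_0^{\sigma+}(x)=\frac{6\,\Gamma(2)}{\ell^2\,\Gamma(2-\sigma)}x^{1-\sigma}-\frac{6\,\Gamma(3)}{\ell^3\,\Gamma(3-\sigma)}x^{2-\sigma},$$ and, for every $k\ge 1$, $$\psi_k^{\sigma+}(x)=x^{1-\sigma}\left(\frac{(2k+3)\Gamma(k+3)}{\ell^2(k+1)\Gamma(k+2-\sigma)}\hat P_k^{(1+\sigma,1-\sigma)}(x)-\frac{(k+2)\Gamma(k+4)}{\ell^3(k+1)\Gamma(k+3-\sigma)}\,x\,\hat P_k^{(1+\sigma,2-\sigma)}(x)-\frac{\Gamma(k+3)}{\ell^3\,\Gamma(k+2-\sigma)}\,x\,\hat P_{k-1}^{(1+\sigma,2-\sigma)}(x)\right).$$ (ii) If $\sigma=2$, then $$\psi_0^{2+}(x)=\frac{-12}{\ell^3},$$ and, for every $k\ge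 1$, $$\psi_k^{2+}(x)=\frac{\lambda_k}{\ell^2}\left((k+4)(k+3)\,x(\ell-x)\,\hat P_{k-2}^{(3,3)}(x)+2\ell(k+3)(\ell-2x)\,\hat P_{k-1}^{(2,2)}(x)-2\ell^2\,\hat P_k^{(1,1)}(x)\right),$$ with the convention $\hat P_{-1}^{(3,3)}:=0$.
   Context: For $a,b>-1$, $P_j^{(a,b)}$, $j=0,1,2,\ldots$, denotes the Jacobi polynomial of degree $j$, in the standard normalization, i.e. $P_0^{(a,b)}(x)=1$, $P_1^{(a,b)}(x)=\frac12[(a+b+2)x+a-b]$ and, for $j\ge1$, $P_{j+1}^{(a,b)}(x)=(A_jx-B_j)P_j^{(a,b)}(x)-C_jP_{j-1}^{(a,b)}(x)$ with $$A_j=\frac{(a+b+2j+1)(a+b+2j+2)}{2(j+1)(a+b+j+1)},\quad B_j=\frac{(b^2-a^2)(a+b+2j+1)}{2(j+1)(a+b+j+1)(a+b+2j)},\quad C_j=\frac{(a+j)(b+j)(a+b+2j+2)}{(j+1)(a+b+j+1)(a+b+2j)}.$$ The left-sided Riemann--Liouville fractional derivative of order $\sigma$ with base point $0$ is $${}_{0}^{R}D_{x}^{\sigma}g(x):=\frac{1}{\Gamma(m-\sigma)}\frac{d^m}{dx^m}\int_0^x(x-t)^{m-\sigma-1}g(t)\,dt,$$ where $m$ is the integer with $m-1\le\sigma<m$. In particular, for $\sigma=2$ and smooth $g$ this is the ordinary second derivative $g''$. *)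

(* Defs.v *)
From Stdlib Require Import Reals.
From Coquelicot Require Import Coquelicot.
Open Scope R_scope.

(** Euler's Gamma function on the positive half-line, as a Riemann integral
    improper at both ends; meaningful for [s > 0] only. *)
Definition Gamma (s : R) : R :=
  RInt_gen (fun t => Rpower t (s - 1) * exp (- t))
           (at_right 0) (Rbar_locally p_infty).

Definition jacA (a b j : R) : R :=
  (a + b + 2 * j + 1) * (a + b + 2 * j + 2) / (2 * (j + 1) * (a + b + j + 1)).

Definition jacB (a b j : R) : R :=
  (b ^ 2 - a ^ 2) * (a + b + 2 * j + 1)
  / (2 * (j + 1) * (a + b + j + 1) * (a + b + 2 * j)).

Definition jacC (a b j : R) : R :=
  (a + j) * (b + j) * (a + b + 2 * j + 2)
  / ((j + 1) * (a + b + j + 1) * (a + b + 2 * j)).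

(** In the last case [j = i + 1], so [S j] is the degree and [i = j - 1]. *)
Fixpoint jacobi (a b : R) (n : nat) (x : R) : R :=
  match n with
  | O => 1
  | S j =>
      match j with
      | O => / 2 * ((a + b + 2) * x + a - b)
      | S i => (jacA a b (INR j) * x - jacB a b (INR j)) * jacobi a b j x
               - jacC a b (INR j) * jacobi a b i x
      end
  end.

Definition jacobi_hat (l a b : R) (n : nat) (x : R) : R :=
  jacobi a b n (2 * x / l - 1).

(** [jacobi_hat] of degree [k - 2], with value 0 for the negative degrees
    (truncated subtraction on [nat] would give degree 0 instead). *)
Definition jacobi_hat_m2 (l a b : R) (k : nat) (x : R) : R :=
  match k with
  | S (S i) => jacobi_hat l a b i x
  | _ => 0
  end.

Definition lam (l : R) (k : nat) : R :=
  1 / l ^ 3 * ((INR k + 2) * (2 * INR k + 3) / (INR k + 1)).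

Definition phi (l : R) (k : nat) (x : R) : R :=
  lam l k * (x * (l - x)) * jacobi_hat l 1 1 k x.

(** [up sigma] is the integer [m] with [m - 1 <= sigma < m]. *)
Definition RL_order (sigma : R) : nat := Z.to_nat (up sigma).

Definition RL_integrand (sigma : R) (g : R -> R) (x t : R) : R :=
  Rpower (x - t) (INR (RL_order sigma) - sigma - 1) * g t.

(** The kernel may be singular at [t = x], whence the improper integral. *)
Definition RL_integral (sigma : R) (g : R -> R) (x : R) : R :=
  RInt_gen (RL_integrand sigma g x) (at_right 0) (at_left x).

(** Left-sided Riemann-Liouville derivative with base point 0, for
    [0 <= sigma] and at [x > 0]. *)
Definition RL_derive (sigma : R) (g : R -> R) (x : R) : R :=
  / Gamma (INR (RL_order sigma) - sigma)
  * Derive_n (RL_integral sigma g) (RL_order sigma) x.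

(** [RInt_gen] and [Derive_n] are total operators with arbitrary values where
    the integral or derivative does not exist; this states that every integral
    and iterated derivative entering [RL_derive sigma g x] exists. *)
Definition ex_RL_derive (sigma : R) (g : R -> R) (x : R) : Prop :=
  locally x (fun y =>
    ex_RInt_gen (RL_integrand sigma g y) (at_right 0) (at_left y)) /\
  locally x (fun y =>
    forall i : nat, (i <= RL_order sigma)%nat ->
      ex_derive_n (RL_integral sigma g) i y).

Definition psi (l sigma : R) (k : nat) (x : R) : R :=
  RL_derive sigma (phi l k) x.

(* Main.v *)
Require Import Defs.
From Stdlib Require Import Reals Lra Lia ZArith Factorial.
From Coquelicot Require Import Coquelicot.
Open Scope R_scope.

(** The Riemann-Liouville derivative is linear and sends [t^p] to
    [Gamma (p+1) / Gamma (p+1-sigma) x^(p-sigma)]; the beta integral behind this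
    is obtained by induction on [p] from [t = y - (y - t)]. Expanding a Jacobi
    polynomial at its left endpoint as a terminating hypergeometric sum turns (i)
    into an identity between the coefficients of [x^(1-sigma+j)], where the
    Pochhammer symbols [(-k)_j] and [(k+3)_j] are common factors and what remains
    is [(k+2)(k+j+3) - (k-j)(k+1) = (2k+3)(j+2)]. For (ii) the derivative is the
    ordinary one, and [P_n^(a,b)' = (n+a+b+1)/2 P_(n-1)^(a+1,b+1)] follows from
    the same expansion. *)

(** * Improper integrals and the Gamma function *)

(** [D] is order-convex, so once both endpoints lie in it the whole segment between them does,
    whichever endpoint is larger. This reduces statements about all points of integration to
    membership of the endpoints. *)
Lemma filter_prod_same_convex (Fa Fb : (R -> Prop) -> Prop) (D : R -> Prop) :
  (forall u v t, D u -> D v -> u <= t <= v -> D t) ->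
  Fa D -> Fb D ->
  filter_prod Fa Fb (fun ab => forall t,
    Rmin (fst ab) (snd ab) <= t <= Rmax (fst ab) (snd ab) -> D t).
Proof.
  intros HD Ha Hb.
  apply Filter_prod with D D; auto.
  intros u v Hu Hv t; cbn.
  unfold Rmin, Rmax; destruct (Rle_dec u v); eauto.
Qed.

(** Fundamental theorem of calculus for improper integrals: [F] has to be a primitive only on [D],
    and at the two ends, where [f] may be singular, only its limits enter. *)
Lemma is_RInt_gen_primitive (Fa Fb : (R -> Prop) -> Prop)
  {FFa : Filter Fa} {FFb : Filter Fb} (D : R -> Prop) (F f : R -> R) (la lb : R) :
  (forall u v t, D u -> D v -> u <= t <= v -> D t) ->
  Fa D -> Fb D ->
  (forall t, D t -> is_derive F t (f t)) ->
  (forall t, D t -> continuous f t) ->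
  filterlim F Fa (locally la) -> filterlim F Fb (locally lb) ->
  is_RInt_gen f Fa Fb (lb - la).
Proof.
  intros HD Ha Hb HF Hf Hla Hlb.
  apply (filterlimi_lim_ext_loc (fun ab => minus (F (snd ab)) (F (fst ab)))).
  - generalize (filter_prod_same_convex Fa Fb D HD Ha Hb).
    apply filter_imp; intros [u v] H; cbn in *.
    apply (is_RInt_derive F f); auto.
  - apply (filterlim_comp_2 (F := filter_prod Fa Fb) (fun ab => F (snd ab)) (fun ab => opp (F (fst ab))) Rplus
             (G := locally lb) (H := locally (opp la))).
    + eapply filterlim_comp; [apply filterlim_snd | exact Hlb].
    + apply (filterlim_comp _ _ _ (fun ab => F (fst ab)) opp _ (locally la)).
      * eapply filterlim_comp; [apply filterlim_fst | exact Hla].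
      * apply (filterlim_opp (V := R_NormedModule)).
    + apply (filterlim_plus (V := R_NormedModule)).
Qed.

Lemma ex_RInt_convex (D : R -> Prop) (f : R -> R) (u v : R) :
  (forall u v t, D u -> D v -> u <= t <= v -> D t) ->
  (forall t, D t -> continuous f t) -> D u -> D v -> ex_RInt f u v.
Proof.
  intros HD Hf Hu Hv; apply (ex_RInt_continuous (V := R_CompleteNormedModule)).
  intros t; unfold Rmin, Rmax; destruct (Rle_dec u v); eauto.
Qed.

(** Comparison test in Cauchy form. On [D] the increments of the integral of [f] are bounded by
    those of [G], a primitive of the dominating [g], so convergence of [G] along the filter makes
    the integral Cauchy. *)
Lemma primitive_lim_dominated (F : (R -> Prop) -> Prop) {FF : ProperFilter F}
  (D : R -> Prop) (c : R) (f G g : R -> R) (lG : R) :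
  (forall u v t, D u -> D v -> u <= t <= v -> D t) ->
  F D -> D c ->
  (forall t, D t -> continuous f t) ->
  (forall t, D t -> is_derive G t (g t)) ->
  (forall t, D t -> continuous g t) ->
  (forall t, D t -> Rabs (f t) <= g t) ->
  filterlim G F (locally lG) ->
  exists l, filterlim (fun u => RInt f c u) F (locally l).
Proof.
  intros HD HF Hc Hf HG Hg Hfg HlG.
  apply (proj1 (filterlim_locally_cauchy (U := R_CompleteSpace) (fun u => RInt f c u))).
  assert (Hle : forall u v, D u -> D v -> u <= v ->
     Rabs (RInt f c v - RInt f c u) <= Rabs (G v - G u)).
  { intros u v Hu Hv Huv.
    assert (Hex : forall a b, D a -> D b -> ex_RInt f a b)
      by (intros; now apply (ex_RInt_convex D)).
    assert (E : RInt f c v - RInt f c u = RInt f u v).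
    { rewrite <- (RInt_Chasles f c u v) by auto.
      change plus with Rplus; cbn; ring. }
    rewrite E.
    apply Rle_trans with (G v - G u); [ | apply Rle_abs].
    apply (norm_RInt_le f g u v); auto.
    - intros t Ht; apply Hfg; eauto.
    - apply (RInt_correct f); auto.
    - apply (is_RInt_derive G g);
        intros t; rewrite Rmin_left, Rmax_right by auto; eauto. }
  intros eps.
  destruct (proj2 (filterlim_locally_cauchy (U := R_CompleteSpace) G)
              (ex_intro _ lG HlG) eps) as [P [HP1 HP2]].
  exists (fun u => D u /\ P u); split; [now apply filter_and | ].
  intros u v [Hu Pu] [Hv Pv].
  specialize (HP2 u v Pu Pv).
  change (Rabs (G v - G u) < eps) in HP2.
  change (Rabs (RInt f c v - RInt f c u) < eps).
  destruct (Rle_or_lt u v) as [h | h].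
  - eapply Rle_lt_trans; [now apply Hle | exact HP2].
  - rewrite Rabs_minus_sym.
    eapply Rle_lt_trans; [apply Hle; auto; lra | ].
    rewrite Rabs_minus_sym; exact HP2.
Qed.

Lemma is_derive_Rpower (e x : R) :
  0 < x -> is_derive (fun t => Rpower t e) x (e * Rpower x (e - 1)).
Proof. intros H; apply is_derive_Reals; now apply derivable_pt_lim_power. Qed.

Lemma continuous_Rpower (e x : R) : 0 < x -> continuous (fun t => Rpower t e) x.
Proof.
  intros H; apply (ex_derive_continuous (V := R_NormedModule)).
  eexists; now apply is_derive_Rpower.
Qed.

Lemma filterlim_Rpower_at_right_0 (e : R) :
  0 < e -> filterlim (fun t => Rpower t e) (at_right 0) (locally 0).
Proof.
  intros He; apply filterlim_locally; intros eps.
  (* The radius is [eps^(1/e)], whose [e]-th power is [eps]. *)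
  exists (mkposreal (Rpower eps (/ e)) (exp_pos _)).
  intros t Ht Ht0; change (Rabs (t - 0) < Rpower eps (/ e)) in Ht.
  change (Rabs (Rpower t e - 0) < eps).
  rewrite Rminus_0_r in *.
  rewrite Rabs_pos_eq in Ht by lra.
  rewrite Rabs_pos_eq by (apply Rlt_le, exp_pos).
  replace (pos eps) with (Rpower (Rpower eps (/ e)) e).
  - now apply Rlt_Rpower_l.
  - rewrite Rpower_mult, Rinv_l, Rpower_1; [auto | apply cond_pos | lra].
Qed.

Lemma at_right_0_pos : at_right 0 (fun t => 0 < t).
Proof. exists (mkposreal 1 Rlt_0_1); auto. Qed.

Lemma at_right_0_lt (y : R) : 0 < y -> at_right 0 (fun t => 0 < t < y).
Proof.
  intros Hy; exists (mkposreal y Hy); intros t Ht H.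
  change (Rabs (t - 0) < y) in Ht.
  rewrite Rabs_pos_eq in Ht; lra.
Qed.

Lemma at_left_gt (y : R) : 0 < y -> at_left y (fun t => 0 < t < y).
Proof.
  intros Hy; exists (mkposreal y Hy); intros t Ht H.
  change (Rabs (t - y) < y) in Ht.
  rewrite Rabs_left in Ht; lra.
Qed.

Definition gamma_density (s t : R) : R := Rpower t (s - 1) * exp (- t).

Lemma continuous_gamma_density (s t : R) : 0 < t -> continuous (gamma_density s) t.
Proof.
  intros Ht; apply (continuous_mult (fun t => Rpower t (s - 1)) (fun t => exp (- t))).
  - now apply continuous_Rpower.
  - apply (ex_derive_continuous (V := R_NormedModule)); auto_derive; auto.
Qed.

Lemma gamma_density_pos (s t : R) : 0 < gamma_density s t.
Proof. apply Rmult_lt_0_compat; apply exp_pos. Qed.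

(** Only [exp (t / 2)] is spent on the power, so that [t^r exp (-t)] is still dominated by a
    multiple of [exp (-t/2)]. With [q = |r| + 1], the inequality [1 + u <= exp u] at
    [u = ln (t / (2q))] gives [ln t <= t / (2q) + ln (2q)]. Multiplying by [q] gives the bound with
    [K = (2q)^q]. *)
Lemma Rpower_le_exp (r : R) :
  exists K, forall t, 1 <= t -> Rpower t r <= K * exp (t / 2).
Proof.
  set (q := Rabs r + 1).
  assert (Hq : 0 < q) by (unfold q; generalize (Rabs_pos r); lra).
  exists (exp (q * ln (2 * q))); intros t Ht.
  unfold Rpower; rewrite <- exp_plus.
  assert (Hl : 0 <= ln t)
    by (rewrite <- ln_1; destruct Ht; [left; apply ln_increasing | right; f_equal]; lra).
  assert (H1 : r * ln t <= q * ln t).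
  { apply Rmult_le_compat_r; auto; unfold q; generalize (Rle_abs r); lra. }
  assert (H2 : ln t <= t / (2 * q) + ln (2 * q)).
  { assert (Hd : 0 < t / (2 * q)) by (apply Rdiv_lt_0_compat; lra).
    replace t with (t / (2 * q) * (2 * q)) at 1 by (field; lra).
    rewrite ln_mult by lra.
    generalize (exp_ineq1_le (ln (t / (2 * q)))).
    rewrite exp_ln by auto; lra. }
  assert (H3 : q * ln t <= q * ln (2 * q) + t / 2).
  { apply Rle_trans with (q * (t / (2 * q) + ln (2 * q))).
    - apply Rmult_le_compat_l; lra.
    - right; field; lra. }
  destruct (Rle_lt_or_eq_dec (r * ln t) (q * ln (2 * q) + t / 2)) as [h | h];
    [lra | left; now apply exp_increasing | right; now rewrite h].
Qed.

Lemma filterlim_exp_half_p_infty (K : R) :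
  filterlim (fun t => K * exp (- (t / 2))) (Rbar_locally p_infty) (locally 0).
Proof.
  replace 0 with (K * 0) by ring.
  apply (is_lim_scal_l (fun t => exp (- (t / 2))) K p_infty 0).
  apply (is_lim_comp exp (fun t => - (t / 2)) p_infty 0 m_infty).
  - apply is_lim_exp_m.
  - intros P [M HM]; exists (- 2 * M); intros t Ht; apply HM; lra.
  - exists 0; intros t _; discriminate.
Qed.

(** The integral is split at 1. Near 0 the density is at most [t^(s-1)], with primitive [t^s / s];
    near infinity it is at most [K exp (-t/2)]. Positivity is obtained along with existence. *)
Lemma gamma_integral (s : R) :
  0 < s ->
  exists g, is_RInt_gen (gamma_density s) (at_right 0) (Rbar_locally p_infty) g /\ 0 < g.
Proof.
  intros Hs.
  assert (Dpos : forall u v t, 0 < u -> 0 < v -> u <= t <= v -> 0 < t) by (intros; lra).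
  assert (Hex : forall u v, 0 < u -> 0 < v -> ex_RInt (gamma_density s) u v).
  { intros; apply (ex_RInt_convex (fun t => 0 < t)); auto.
    intros; now apply continuous_gamma_density. }
  assert (Habs : forall t, Rabs (gamma_density s t) = gamma_density s t)
    by (intros; apply Rabs_pos_eq, Rlt_le, gamma_density_pos).
  destruct (primitive_lim_dominated (at_right 0) (fun t => 0 < t <= 1) 1
    (gamma_density s) (fun t => / s * Rpower t s) (fun t => Rpower t (s - 1)) (/ s * 0))
    as [la Hla]; try lra.
  { intros; lra. }
  { generalize (at_right_0_lt 1 Rlt_0_1); apply filter_imp; intros; lra. }
  { intros; apply continuous_gamma_density; lra. }
  { intros t Ht.
    replace (Rpower t (s - 1)) with (/ s * (s * Rpower t (s - 1))) by (field; lra).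
    apply (is_derive_scal (fun t => Rpower t s)), is_derive_Rpower; lra. }
  { intros; apply continuous_Rpower; lra. }
  { intros t Ht; rewrite Habs; unfold gamma_density.
    rewrite <- (Rmult_1_r (Rpower t (s - 1))) at 2.
    apply Rmult_le_compat_l; [apply Rlt_le, exp_pos | ].
    rewrite <- exp_0; left; apply exp_increasing; lra. }
  { eapply filterlim_comp; [now apply filterlim_Rpower_at_right_0 | ].
    apply (filterlim_scal_r (/ s) 0). }
  destruct (Rpower_le_exp (s - 1)) as [K HK].
  destruct (primitive_lim_dominated (Rbar_locally p_infty) (fun t => 1 <= t) 1
    (gamma_density s) (fun t => - 2 * K * exp (- (t / 2))) (fun t => K * exp (- (t / 2))) 0)
    as [lb Hlb]; try lra.
  { intros; lra. }
  { exists 1; intros; lra. }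
  { intros; apply continuous_gamma_density; lra. }
  { intros t Ht; auto_derive; auto; unfold Rdiv; field. }
  { intros; apply (ex_derive_continuous (V := R_NormedModule)); auto_derive; auto. }
  { intros t Ht; rewrite Habs; unfold gamma_density.
    replace (K * exp (- (t / 2))) with (K * exp (t / 2) * exp (- t)).
    - apply Rmult_le_compat_r; [apply Rlt_le, exp_pos | auto].
    - rewrite Rmult_assoc, <- exp_plus; do 2 f_equal; field. }
  { apply filterlim_exp_half_p_infty. }
  exists (lb - la); split.
  - apply (is_RInt_gen_primitive _ _ (fun t => 0 < t) (fun u => RInt (gamma_density s) 1 u));
      auto.
    + apply at_right_0_pos.
    + exists 0; auto.
    + intros t Ht; apply (is_derive_RInt _ _ 1).
      * exists (mkposreal t Ht); intros u Hu; apply (RInt_correct (gamma_density s)).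
        change (Rabs (u - t) < t) in Hu; apply Rabs_def2 in Hu.
        apply Hex; lra.
      * now apply continuous_gamma_density.
    + intros; now apply continuous_gamma_density.
  (* The primitive is based at 1, so its limit [la] at 0 is at most 0, while its limit [lb] at
     infinity is at least the integral over [[1, 2]], which is strictly positive. *)
  - assert (Hge0 : forall u v, 0 < u <= v -> 0 <= RInt (gamma_density s) u v).
    { intros u v Huv; apply RInt_ge_0; [lra | apply Hex; lra | ].
      intros; apply Rlt_le, gamma_density_pos. }
    assert (Ha : la <= 0).
    { apply (filterlim_le (F := at_right 0) (fun u => RInt (gamma_density s) 1 u)
               (fun _ => 0) la 0); [ | exact Hla | apply filterlim_const].
      generalize (at_right_0_lt 1 Rlt_0_1); apply filter_imp; intros u Hu.
      rewrite <- (opp_RInt_swap (gamma_density s)) by (apply Hex; lra).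
      change (- RInt (gamma_density s) u 1 <= 0).
      assert (H := Hge0 u 1 ltac:(lra)); lra. }
    assert (H12 : 0 < RInt (gamma_density s) 1 2).
    { apply RInt_gt_0; try lra; intros.
      - apply gamma_density_pos.
      - apply continuous_gamma_density; lra. }
    assert (Hb : RInt (gamma_density s) 1 2 <= lb).
    { apply (filterlim_le (F := Rbar_locally p_infty) (fun _ => RInt (gamma_density s) 1 2)
        (fun u => RInt (gamma_density s) 1 u) (RInt (gamma_density s) 1 2) lb);
        [ | apply filterlim_const | exact Hlb].
      exists 2; intros u Hu.
      rewrite <- (RInt_Chasles (gamma_density s) 1 2 u) by (apply Hex; lra).
      change plus with Rplus; cbv beta.
      assert (H := Hge0 2 u ltac:(lra)); lra. }
    lra.
Qed.

Lemma is_RInt_gen_Gamma (s : R) :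
  0 < s ->
  is_RInt_gen (gamma_density s) (at_right 0) (Rbar_locally p_infty) (Gamma s).
Proof.
  intros Hs; destruct (gamma_integral s Hs) as [g [Hg _]].
  unfold Gamma; fold (gamma_density s).
  now rewrite (is_RInt_gen_unique _ _ Hg).
Qed.

Lemma Gamma_pos (s : R) : 0 < s -> 0 < Gamma s.
Proof.
  intros Hs; destruct (gamma_integral s Hs) as [g [Hg Hpos]].
  unfold Gamma; fold (gamma_density s).
  now rewrite (is_RInt_gen_unique _ _ Hg).
Qed.

Lemma Gamma_1 : Gamma 1 = 1.
Proof.
  unfold Gamma; apply is_RInt_gen_unique.
  cut (is_RInt_gen (gamma_density 1) (at_right 0) (Rbar_locally p_infty) (- 0 - - exp (- 0))).
  { now replace (- 0 - - exp (- 0)) with 1 by (rewrite Ropp_0, exp_0; ring). }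
  apply (is_RInt_gen_primitive _ _ (fun t => 0 < t) (fun t => - exp (- t))).
  - intros; lra.
  - apply at_right_0_pos.
  - exists 0; auto.
  - intros t Ht; unfold gamma_density; rewrite Rminus_diag, Rpower_O by auto; auto_derive; auto; ring.
  - intros; now apply (continuous_gamma_density 1).
  - apply (filterlim_filter_le_1 (F := locally 0)); [apply filter_le_within | ].
    apply (ex_derive_continuous (V := R_NormedModule) (fun t => - exp (- t))); auto_derive; auto.
  - apply (is_lim_opp (fun t => exp (- t)) p_infty 0).
    apply (is_lim_comp exp (fun t => - t) p_infty 0 m_infty).
    + apply is_lim_exp_m.
    + apply (is_lim_opp (fun t => t) p_infty p_infty), is_lim_id.
    + exists 0; intros t _; discriminate.
Qed.

(** Integration by parts. The function [t^s exp (-t)] is both the integrand of [Gamma (s + 1)] and a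
    primitive of [s * gamma_density s - gamma_density (s + 1)]; it tends to 0 at both ends, so the
    two integrals agree. *)
Lemma Gamma_succ (s : R) : 0 < s -> Gamma (s + 1) = s * Gamma s.
Proof.
  intros Hs.
  unfold Gamma at 1; fold (gamma_density (s + 1)); apply is_RInt_gen_unique.
  assert (E : forall t, gamma_density (s + 1) t = Rpower t s * exp (- t))
    by (intros; unfold gamma_density; do 2 f_equal; ring).
  assert (Hd : is_RInt_gen (fun t => s * gamma_density s t - gamma_density (s + 1) t)
                 (at_right 0) (Rbar_locally p_infty) (0 - 0)).
  { apply (is_RInt_gen_primitive _ _ (fun t => 0 < t) (gamma_density (s + 1))).
    - intros; lra.
    - apply at_right_0_pos.
    - exists 0; auto.
    - intros t Ht; apply (is_derive_ext (fun t => Rpower t s * exp (- t))).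
      { now intros; rewrite E. }
      replace (s * gamma_density s t - gamma_density (s + 1) t)
        with (plus (mult (s * Rpower t (s - 1)) (exp (- t))) (mult (Rpower t s) (- exp (- t)))).
      + apply (is_derive_mult (fun t => Rpower t s) (fun t => exp (- t))).
        * now apply is_derive_Rpower.
        * auto_derive; auto; ring.
        * intros; apply Rmult_comm.
      + rewrite E; unfold gamma_density; change mult with Rmult; change plus with Rplus; cbn; ring.
    - intros t Ht; apply (continuous_minus (fun t => s * gamma_density s t)).
      + apply (continuous_scal_r s (gamma_density s)); now apply continuous_gamma_density.
      + now apply continuous_gamma_density.
    - apply (filterlim_ext (fun t => Rpower t s * exp (- t))); [now intros; rewrite E | ].
      replace 0 with (0 * exp (- 0)) at 2 by ring.
      eapply filterlim_comp_2;
        [now apply filterlim_Rpower_at_right_0 | | apply (filterlim_mult (K := R_AbsRing))].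
      apply (filterlim_filter_le_1 (F := locally 0)); [apply filter_le_within | ].
      apply (ex_derive_continuous (V := R_NormedModule) (fun t => exp (- t))); auto_derive; auto.
    - destruct (Rpower_le_exp s) as [K HK].
      apply (filterlim_le_le (fun _ => 0) (gamma_density (s + 1)) (fun t => K * exp (- (t / 2))) 0).
      + exists 1; intros t Ht; split; [apply Rlt_le, gamma_density_pos | ].
        rewrite E.
        replace (K * exp (- (t / 2))) with (K * exp (t / 2) * exp (- t)).
        * apply Rmult_le_compat_r; [apply Rlt_le, exp_pos | apply HK; lra].
        * rewrite Rmult_assoc, <- exp_plus; do 2 f_equal; field.
      + apply filterlim_const.
      + apply filterlim_exp_half_p_infty. }
  replace (s * Gamma s) with (minus (scal s (Gamma s)) (0 - 0))
    by (unfold minus; change plus with Rplus; change opp with Ropp; change scal with Rmult;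
        cbn; ring).
  apply (is_RInt_gen_ext
    (fun t => minus (scal s (gamma_density s t)) (s * gamma_density s t - gamma_density (s + 1) t))).
  - apply filter_forall; intros ab t _.
    unfold minus; change plus with Rplus; change opp with Ropp; change scal with Rmult; cbn; ring.
  - apply (is_RInt_gen_minus (fun t => scal s (gamma_density s t)) _ (scal s (Gamma s)));
      [ | exact Hd].
    apply (is_RInt_gen_scal (gamma_density s)); now apply is_RInt_gen_Gamma.
Qed.

(** * Riemann-Liouville derivatives *)

Lemma INR_fact_Gamma (n : nat) : Gamma (INR n + 1) = INR (fact n).
Proof.
  induction n as [ | n IH].
  - cbn; rewrite Rplus_0_l; apply Gamma_1.
  - assert (0 <= INR n) by apply pos_INR.
    rewrite fact_simpl, mult_INR, <- IH, S_INR.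
    apply Gamma_succ; lra.
Qed.

(** The induction on [p] is for all [a] at once: writing one factor [t] as [y - (y - t)] gives [y]
    times the integral for [(a, p)] minus the integral for [(a + 1, p)]. After clearing Gamma
    functions the step is [(a + p + 1) - a = p + 1]. *)
Lemma is_RInt_gen_beta (p : nat) (a y : R) :
  0 < a -> 0 < y ->
  is_RInt_gen (fun t => Rpower (y - t) (a - 1) * t ^ p) (at_right 0) (at_left y)
    (Gamma a * Gamma (INR p + 1) / Gamma (a + INR p + 1) * Rpower y (a + INR p)).
Proof.
  intros Ha Hy; revert a Ha; induction p as [ | p IH]; intros a Ha.
  - cbn [INR pow]; rewrite Rplus_0_l, Rplus_0_r, Gamma_1, Gamma_succ by auto.
    (* The value is rewritten as the difference of the limits of the primitive [- (y - t)^a / a] at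
       [y] and at 0. *)
    replace (Gamma a * 1 / (a * Gamma a) * Rpower y a)
      with (- / a * 0 - (- / a * Rpower (y - 0) a))
      by (rewrite Rminus_0_r; generalize (Gamma_pos a Ha); intros; field; lra).
    apply (is_RInt_gen_primitive _ _ (fun t => 0 < t < y) (fun t => - / a * Rpower (y - t) a)).
    + intros; lra.
    + now apply at_right_0_lt.
    + now apply at_left_gt.
    + intros t Ht.
      replace (Rpower (y - t) (a - 1) * 1)
        with (- / a * (-1 * (a * Rpower (y - t) (a - 1)))) by (field; lra).
      apply (is_derive_scal (fun t => Rpower (y - t) a)).
      apply (is_derive_comp (fun u => Rpower u a) (fun t => y - t)).
      * apply is_derive_Rpower; lra.
      * auto_derive; auto; ring.
    + intros t Ht; apply (continuous_ext (fun t => Rpower (y - t) (a - 1)));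
        [intros; symmetry; apply Rmult_1_r | ].
      apply (continuous_comp (fun t => y - t) (fun u => Rpower u (a - 1))).
      * apply (ex_derive_continuous (V := R_NormedModule)); auto_derive; auto.
      * apply continuous_Rpower; lra.
    + apply (filterlim_filter_le_1 (F := locally 0)); [apply filter_le_within | ].
      apply (continuous_scal_r (- / a) (fun t => Rpower (y - t) a)).
      apply (continuous_comp (fun t => y - t) (fun u => Rpower u a)).
      * apply (ex_derive_continuous (V := R_NormedModule)); auto_derive; auto.
      * apply continuous_Rpower; lra.
    + apply (filterlim_comp _ _ _ (fun t => Rpower (y - t) a) (Rmult (- / a)) _ (locally 0));
        [ | apply (filterlim_scal_r (- / a) 0)].
      apply (filterlim_comp _ _ _ (fun t => y - t) (fun u => Rpower u a) _ (at_right 0));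
        [ | now apply filterlim_Rpower_at_right_0].
      (* The reflection [t -> y - t] carries left neighbourhoods of [y] to right neighbourhoods of
         0. *)
      intros P [eps HP]; exists eps; intros t Ht Hty; apply HP; [ | lra].
      change (Rabs (t - y) < eps) in Ht; change (Rabs (y - t - 0) < eps).
      rewrite Rminus_0_r, Rabs_minus_sym; exact Ht.
  - assert (Hp := pos_INR p); rewrite !S_INR.
    assert (H1 := IH a Ha).
    assert (H2 := IH (a + 1) ltac:(lra)).
    apply (is_RInt_gen_ext (fun t => minus (scal y (Rpower (y - t) (a - 1) * t ^ p))
                                     (Rpower (y - t) (a + 1 - 1) * t ^ p))).
    { generalize (filter_prod_same_convex (at_right 0) (at_left y) (fun t => 0 < t < y)
        ltac:(intros; lra) (at_right_0_lt y Hy) (at_left_gt y Hy)).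
      apply filter_imp; intros [u v] H t Ht.
      destruct (H t ltac:(lra)) as [Ht0 Hty].
      replace (a + 1 - 1) with (a - 1 + 1) by ring.
      rewrite Rpower_plus, (Rpower_1 (y - t)) by lra.
      unfold minus; change plus with Rplus; change opp with Ropp; change scal with Rmult.
      cbn; ring. }
    replace (_ * Rpower y (a + (INR p + 1))) with
      (minus (scal y (Gamma a * Gamma (INR p + 1) / Gamma (a + INR p + 1) * Rpower y (a + INR p)))
         (Gamma (a + 1) * Gamma (INR p + 1) / Gamma (a + 1 + INR p + 1)
          * Rpower y (a + 1 + INR p))).
    { apply (is_RInt_gen_minus (fun t => scal y (Rpower (y - t) (a - 1) * t ^ p))).
      - now apply (is_RInt_gen_scal (fun t => Rpower (y - t) (a - 1) * t ^ p)).
      - exact H2. }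
    unfold minus; change plus with Rplus; change opp with Ropp; change scal with Rmult; cbv beta.
    rewrite (Gamma_succ a), (Gamma_succ (INR p + 1)) by lra.
    replace (a + 1 + INR p + 1) with (a + INR p + 1 + 1) by ring.
    replace (a + (INR p + 1) + 1) with (a + INR p + 1 + 1) by ring.
    rewrite (Gamma_succ (a + INR p + 1)) by lra.
    replace (a + 1 + INR p) with (a + INR p + 1) by ring.
    replace (a + (INR p + 1)) with (a + INR p + 1) by ring.
    rewrite (Rpower_plus (a + INR p) 1), Rpower_1 by auto.
    assert (H3 := Gamma_pos (a + INR p + 1) ltac:(lra)).
    match goal with |- @eq _ ?u ?v => change (@eq R u v) end; field; lra.
Qed.

Lemma RL_order_spec (sigma : R) :
  0 <= sigma -> sigma < INR (RL_order sigma) <= sigma + 1.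
Proof.
  intros Hs; unfold RL_order.
  destruct (archimed sigma) as [H1 H2].
  rewrite INR_IZR_INZ, Z2Nat.id; [lra | ].
  apply le_IZR; lra.
Qed.

(** The falling factorial [b (b-1) ... (b-n+1)] is written as a quotient of Gamma values; the
    hypothesis keeps both arguments positive, where [Gamma] is meaningful. *)
Lemma Derive_n_Rpower (b : R) (n : nat) :
  0 < b + 1 - INR n -> forall y, 0 < y ->
  Derive_n (fun y => Rpower y b) n y
    = Gamma (b + 1) / Gamma (b + 1 - INR n) * Rpower y (b - INR n)
  /\ ex_derive_n (fun y => Rpower y b) n y.
Proof.
  induction n as [ | n IH]; intros Hb y Hy.
  - cbn [INR Derive_n] in *; rewrite !Rminus_0_r in *; split; [ | exact I].
    assert (H := Gamma_pos (b + 1) Hb); field; lra.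
  - rewrite S_INR in *.
    assert (Hd : is_derive (Derive_n (fun y => Rpower y b) n) y
      (Gamma (b + 1) / Gamma (b + 1 - (INR n + 1)) * Rpower y (b - (INR n + 1)))).
    (* The formula for the [n]-th derivative is available only on the positive half-line, which
       contains a neighbourhood of [y]. *)
    { apply (is_derive_ext_loc
        (fun y => Gamma (b + 1) / Gamma (b + 1 - INR n) * Rpower y (b - INR n))).
      - exists (mkposreal y Hy); intros z Hz.
        change (Rabs (z - y) < y) in Hz; apply Rabs_def2 in Hz.
        symmetry; apply IH; lra.
      - replace (b + 1 - INR n) with (b - INR n + 1) by ring.
        rewrite (Gamma_succ (b - INR n)) by lra.
        replace (b + 1 - (INR n + 1)) with (b - INR n) by ring.
        replace (b - (INR n + 1)) with (b - INR n - 1) by ring.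
        assert (H := Gamma_pos (b - INR n) ltac:(lra)).
        replace (_ * Rpower y (b - INR n - 1)) with
          (Gamma (b + 1) / ((b - INR n) * Gamma (b - INR n))
           * ((b - INR n) * Rpower y (b - INR n - 1))) by (field; lra).
        apply (is_derive_scal (fun y => Rpower y (b - INR n))).
        now apply is_derive_Rpower. }
    split; [now apply is_derive_unique | eexists; exact Hd].
Qed.

(* Bundles the existence of every integral and derivative involved with their
   value on the half-line, so that it is closed under linear combinations. *)
Definition is_RL_derive (sigma : R) (g v : R -> R) : Prop :=
  exists G,
    (forall y, 0 < y -> is_RInt_gen (RL_integrand sigma g y) (at_right 0) (at_left y) (G y)) /\
    (forall y, 0 < y -> forall i, (i <= RL_order sigma)%nat -> ex_derive_n G i y) /\
    (forall y, 0 < y ->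
       Derive_n G (RL_order sigma) y = Gamma (INR (RL_order sigma) - sigma) * v y).

Lemma locally_pos (x : R) : 0 < x -> locally x (fun y => 0 < y).
Proof. intros Hx; now apply (open_gt 0). Qed.

Lemma is_RL_derive_correct (sigma : R) (g v : R -> R) (x : R) :
  0 <= sigma -> 0 < x -> is_RL_derive sigma g v ->
  ex_RL_derive sigma g x /\ RL_derive sigma g x = v x.
Proof.
  intros Hs Hx [G [HG [Hex HD]]].
  assert (E : forall y, 0 < y -> RL_integral sigma g y = G y).
  { intros y Hy; apply is_RInt_gen_unique; auto. }
  (* [G] and the integral operator agree only on the positive half-line; being open, it is enough
     for comparing derivatives there. *)
  assert (El : forall y, 0 < y -> locally y (fun z => G z = RL_integral sigma g z)).
  { intros y Hy; generalize (locally_pos y Hy); apply filter_imp; intros; now rewrite E. }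
  repeat split.
  - generalize (locally_pos x Hx); apply filter_imp; intros y Hy; exists (G y); auto.
  - generalize (locally_pos x Hx); apply filter_imp; intros y Hy i Hi.
    apply (ex_derive_n_ext_loc G); auto.
  - unfold RL_derive; rewrite <- (Derive_n_ext_loc G) by auto.
    rewrite HD by auto.
    assert (H := Gamma_pos (INR (RL_order sigma) - sigma)).
    destruct (RL_order_spec sigma Hs); field; apply Rgt_not_eq, H; lra.
Qed.

Lemma is_RL_derive_ext (sigma : R) (g h v w : R -> R) :
  (forall t, g t = h t) -> (forall y, 0 < y -> v y = w y) ->
  is_RL_derive sigma g v -> is_RL_derive sigma h w.
Proof.
  intros Hgh Hvw [G [HG [Hex HD]]]; exists G; repeat split; auto.
  - intros y Hy; apply (is_RInt_gen_ext (RL_integrand sigma g y)); auto.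
    apply filter_forall; intros ab t _; unfold RL_integrand; now rewrite Hgh.
  - intros y Hy; rewrite HD, Hvw; auto.
Qed.

Lemma is_RL_derive_plus (sigma : R) (g h v w : R -> R) :
  is_RL_derive sigma g v -> is_RL_derive sigma h w ->
  is_RL_derive sigma (fun t => g t + h t) (fun y => v y + w y).
Proof.
  intros [G [HG [HexG HDG]]] [H [HH [HexH HDH]]]; exists (fun y => G y + H y).
  (* Additivity of iterated derivatives asks for all lower derivatives in a neighbourhood, not just
     at the point. *)
  assert (HlG : forall y i, 0 < y -> (i <= RL_order sigma)%nat ->
    locally y (fun z => forall k, (k <= i)%nat -> ex_derive_n G k z)).
  { intros y i Hy Hi; generalize (locally_pos y Hy); apply filter_imp.
    intros; apply HexG; auto; lia. }
  assert (HlH : forall y i, 0 < y -> (i <= RL_order sigma)%nat ->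
    locally y (fun z => forall k, (k <= i)%nat -> ex_derive_n H k z)).
  { intros y i Hy Hi; generalize (locally_pos y Hy); apply filter_imp.
    intros; apply HexH; auto; lia. }
  repeat split.
  - intros y Hy.
    apply (is_RInt_gen_ext (fun t => plus (RL_integrand sigma g y t) (RL_integrand sigma h y t))).
    + apply filter_forall; intros ab t _; unfold RL_integrand; change plus with Rplus; cbn; ring.
    + apply (is_RInt_gen_plus (RL_integrand sigma g y)); auto.
  - intros y Hy i Hi; apply ex_derive_n_plus; auto.
  - intros y Hy; rewrite Derive_n_plus, HDG, HDH by auto; ring.
Qed.

Lemma is_RL_derive_scal (sigma c : R) (g v : R -> R) :
  is_RL_derive sigma g v -> is_RL_derive sigma (fun t => c * g t) (fun y => c * v y).
Proof.
  intros [G [HG [Hex HD]]]; exists (fun y => c * G y); repeat split.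
  - intros y Hy.
    apply (is_RInt_gen_ext (fun t => scal c (RL_integrand sigma g y t))).
    + apply filter_forall; intros ab t _; unfold RL_integrand; change scal with Rmult; cbn; ring.
    + apply (is_RInt_gen_scal (RL_integrand sigma g y)); auto.
  - intros y Hy i Hi; apply ex_derive_n_scal_l; auto.
  - intros y Hy; rewrite Derive_n_scal_l, HD by auto; ring.
Qed.

Lemma is_RL_derive_sum (sigma : R) (g v : nat -> R -> R) (n : nat) :
  (forall i, is_RL_derive sigma (g i) (v i)) ->
  is_RL_derive sigma (fun t => sum_f_R0 (fun i => g i t) n)
    (fun y => sum_f_R0 (fun i => v i y) n).
Proof.
  intros H; induction n as [ | n IH]; cbn; auto.
  now apply is_RL_derive_plus.
Qed.

(** With [a = m - sigma], the fractional integral is a multiple of [y^(a+p)]. Differentiating it [m]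
    times brings in [Gamma (a + p + 1)], which cancels the denominator of the beta integral. The
    bound [sigma < p + 1] keeps the argument of the remaining denominator positive. *)
Lemma is_RL_derive_pow (sigma : R) (p : nat) :
  0 <= sigma < INR p + 1 ->
  is_RL_derive sigma (fun t => t ^ p)
    (fun y => Gamma (INR p + 1) / Gamma (INR p + 1 - sigma) * Rpower y (INR p - sigma)).
Proof.
  intros Hs; destruct (RL_order_spec sigma ltac:(lra)) as [Hm1 Hm2].
  set (m := RL_order sigma) in *; set (a := INR m - sigma).
  assert (Hp := pos_INR p).
  assert (Ha : 0 < a) by (unfold a; lra).
  set (K := Gamma a * Gamma (INR p + 1) / Gamma (a + INR p + 1)).
  exists (fun y => K * Rpower y (a + INR p)); repeat split.
  - intros y Hy; now apply is_RInt_gen_beta.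
  - intros y Hy i Hi; apply ex_derive_n_scal_l, Derive_n_Rpower; auto.
    apply le_INR in Hi; fold m in Hi; unfold a; lra.
  - intros y Hy; fold m a.
    rewrite Derive_n_scal_l.
    destruct (Derive_n_Rpower (a + INR p) m ltac:(unfold a; lra) y Hy) as [-> _].
    replace (a + INR p + 1 - INR m) with (INR p + 1 - sigma) by (unfold a; ring).
    replace (a + INR p - INR m) with (INR p - sigma) by (unfold a; ring).
    unfold K.
    assert (H1 := Gamma_pos (a + INR p + 1) ltac:(lra)).
    assert (H2 := Gamma_pos (INR p + 1 - sigma) ltac:(lra)).
    field; lra.
Qed.

(* For integral [sigma] the order is [sigma + 1] and the kernel is constant. *)
Lemma is_RL_derive_2 (g g1 g2 : R -> R) :
  (forall y, is_derive g y (g1 y)) -> (forall y, is_derive g1 y (g2 y)) ->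
  is_RL_derive 2 g g2.
Proof.
  intros H1 H2.
  assert (Hc : forall y, continuous g y).
  { intros; apply (ex_derive_continuous (V := R_NormedModule)); now eexists. }
  assert (Hm : RL_order 2 = 3%nat).
  { unfold RL_order; replace (up 2) with 3%Z; [reflexivity | ].
    apply tech_up; lra. }
  assert (H0 : forall y, is_derive (fun z => RInt g 0 z) y (g y)).
  { intros y; apply (is_derive_RInt _ _ 0); auto.
    apply filter_forall; intros z; apply (RInt_correct g).
    apply (ex_RInt_continuous (V := R_CompleteNormedModule)); auto. }
  set (G := fun z => RInt g 0 z) in *.
  assert (E1 : forall y, Derive_n G 1 y = g y) by (intros; now apply is_derive_unique).
  assert (D1 : forall y, is_derive (Derive_n G 1) y (g1 y)).
  { intros; apply (is_derive_ext g); auto. }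
  assert (E2 : forall y, Derive_n G 2 y = g1 y) by (intros; now apply is_derive_unique).
  assert (D2 : forall y, is_derive (Derive_n G 2) y (g2 y)).
  { intros; apply (is_derive_ext g1); auto. }
  exists G; rewrite Hm; repeat split.
  - intros y Hy; replace (G y) with (G y - G 0)
      by (unfold G; rewrite RInt_point; apply Rminus_0_r).
    apply (is_RInt_gen_ext g).
    + generalize (filter_prod_same_convex (at_right 0) (at_left y) (fun t => 0 < t < y)
        ltac:(intros; lra) (at_right_0_lt y Hy) (at_left_gt y Hy)).
      apply filter_imp; intros [u v] H t Ht.
      destruct (H t ltac:(lra)) as [Ht0 Hty].
      unfold RL_integrand; rewrite Hm.
      replace (INR 3 - 2 - 1) with 0 by (cbn; ring).
      rewrite Rpower_O by lra; symmetry; apply Rmult_1_l.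
    + apply (is_RInt_gen_primitive _ _ (fun _ => True) G); auto.
      * apply filter_true.
      * apply filter_true.
      * apply (filterlim_filter_le_1 (F := locally 0)); [apply filter_le_within | ].
        apply (ex_derive_continuous (V := R_NormedModule)); now eexists.
      * apply (filterlim_filter_le_1 (F := locally y)); [apply filter_le_within | ].
        apply (ex_derive_continuous (V := R_NormedModule)); now eexists.
  - intros y _ [ | [ | [ | [ | i]]]] Hi; try lia.
    + exact I.
    + eexists; apply H0.
    + eexists; apply D1.
    + eexists; apply D2.
  - intros y _; replace (INR 3 - 2) with 1 by (cbn; ring).
    rewrite Gamma_1, Rmult_1_l; now apply is_derive_unique.
Qed.

(** * Jacobi polynomials *)

Fixpoint poch (x : R) (n : nat) : R :=
  match n with
  | O => 1
  | S m => poch x m * (x + INR m)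
  end.

Lemma poch_S (x : R) (n : nat) : poch x (S n) = poch x n * (x + INR n).
Proof. reflexivity. Qed.

Lemma poch_S_l (x : R) (n : nat) : poch x (S n) = x * poch (x + 1) n.
Proof.
  induction n as [ | n IH]; [cbn; ring | ].
  rewrite poch_S, IH, poch_S, S_INR; ring.
Qed.

Lemma poch_pos (x : R) (n : nat) : 0 < x -> 0 < poch x n.
Proof.
  intros Hx; induction n as [ | n IH]; cbn [poch]; [lra | ].
  apply Rmult_lt_0_compat; auto; generalize (pos_INR n); lra.
Qed.

Lemma poch_opp_vanish (n j : nat) : (n < j)%nat -> poch (- INR n) j = 0.
Proof.
  induction 1 as [ | j _ IH]; rewrite poch_S; [ | rewrite IH]; ring.
Qed.

Lemma poch_2_fact (n : nat) : poch 2 n = INR (fact (S n)).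
Proof.
  induction n as [ | n IH]; [cbn; ring | ].
  rewrite poch_S, IH, (fact_simpl (S n)), mult_INR, !S_INR; ring.
Qed.

(* [jacobi a b n (2 z - 1)] is
   [(-1)^n (b+1)_n / n! * 2F1 (-n, n+a+b+1; b+1; z)], by reflection of the usual
   expansion at the other endpoint; [poch (- n) j] truncates the series. *)
Definition jac_coef (a b : R) (n j : nat) : R :=
  (-1) ^ n * poch (b + 1) n / INR (fact n)
  * (poch (- INR n) j * poch (INR n + (a + b) + 1) j / (poch (b + 1) j * INR (fact j))).

Lemma jac_coef_vanish (a b : R) (n j : nat) : (n < j)%nat -> jac_coef a b n j = 0.
Proof.
  intros H; unfold jac_coef; rewrite poch_opp_vanish by auto; unfold Rdiv; ring.
Qed.

(** Constant term of the three-term recurrence at [x = 2 z - 1], where [A x - B] becomes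
    [2 A z - (A + B)]. The recurrence index is at least 1, which makes the denominator [a + b + 2 j]
    positive. *)
Lemma jac_coef_rec_0 (a b : R) (n : nat) :
  -1 < a -> -1 < b ->
  jac_coef a b (S (S n)) 0 =
    - (jacA a b (INR (S n)) + jacB a b (INR (S n))) * jac_coef a b (S n) 0
    - jacC a b (INR (S n)) * jac_coef a b n 0.
Proof.
  intros Ha Hb; unfold jac_coef, jacA, jacB, jacC.
  rewrite !fact_simpl, !mult_INR, !poch_S, !S_INR; cbn [poch fact pow INR].
  assert (Hn := pos_INR n); assert (Hf := INR_fact_lt_0 n).
  field; repeat split; lra.
Qed.

(** Coefficient of [z^(j+1)] in the same recurrence. Every Pochhammer symbol depending on the degree
    is reduced to [(-n)_i] or [(n+a+b+3)_i] with [i = j - 1]; what remains is a rational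
    identity. *)
Lemma jac_coef_rec_S (a b : R) (n j : nat) :
  -1 < a -> -1 < b ->
  jac_coef a b (S (S n)) (S j) =
    jacA a b (INR (S n)) * (2 * jac_coef a b (S n) j)
    - (jacA a b (INR (S n)) + jacB a b (INR (S n))) * jac_coef a b (S n) (S j)
    - jacC a b (INR (S n)) * jac_coef a b n (S j).
Proof.
  intros Ha Hb; unfold jac_coef, jacA, jacB, jacC.
  assert (Hn := pos_INR n); assert (Hf := INR_fact_lt_0 n).
  destruct j as [ | i].
  (* For [j = 0] the symbols are too short to peel two factors off, so they are computed
     outright. *)
  - rewrite !fact_simpl, !mult_INR, !poch_S, !S_INR; cbn [poch fact pow INR].
    field; repeat split; lra.
  - assert (Hi := pos_INR i); assert (Hfi := INR_fact_lt_0 i).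
    assert (Hp := poch_pos (b + 1) i ltac:(lra)).
    replace (poch (- INR (S (S n))) (S (S i)))
      with ((INR n + 2) * (INR n + 1) * poch (- INR n) i)
      by (rewrite !poch_S_l, !S_INR;
          replace (- (INR n + 1 + 1) + 1 + 1) with (- INR n) by ring; ring).
    replace (poch (- INR (S n)) (S (S i)))
      with (- (INR n + 1) * (poch (- INR n) i * (- INR n + INR i)))
      by (rewrite poch_S_l, S_INR;
          replace (- (INR n + 1) + 1) with (- INR n) by ring; rewrite poch_S; ring).
    replace (poch (- INR (S n)) (S i)) with (- (INR n + 1) * poch (- INR n) i)
      by (rewrite poch_S_l, S_INR;
          replace (- (INR n + 1) + 1) with (- INR n) by ring; ring).
    set (q := poch (INR n + (a + b) + 3) i).
    replace (poch (INR (S (S n)) + (a + b) + 1) (S (S i)))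
      with (q * (INR n + (a + b) + 3 + INR i) * (INR n + (a + b) + 4 + INR i))
      by (rewrite !poch_S, !S_INR; unfold q;
          replace (INR n + 1 + 1 + (a + b) + 1) with (INR n + (a + b) + 3) by ring; ring).
    replace (poch (INR (S n) + (a + b) + 1) (S (S i)))
      with ((INR n + (a + b) + 2) * (q * (INR n + (a + b) + 3 + INR i)))
      by (rewrite poch_S_l, poch_S, !S_INR; unfold q;
          replace (INR n + 1 + (a + b) + 1 + 1) with (INR n + (a + b) + 3) by ring; ring).
    replace (poch (INR (S n) + (a + b) + 1) (S i)) with ((INR n + (a + b) + 2) * q)
      by (rewrite poch_S_l, !S_INR; unfold q;
          replace (INR n + 1 + (a + b) + 1 + 1) with (INR n + (a + b) + 3) by ring; ring).
    replace (poch (INR n + (a + b) + 1) (S (S i)))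
      with ((INR n + (a + b) + 1) * (INR n + (a + b) + 2) * q)
      by (rewrite !poch_S_l; unfold q;
          replace (INR n + (a + b) + 1 + 1 + 1) with (INR n + (a + b) + 3) by ring; ring).
    rewrite !fact_simpl, !mult_INR, !poch_S, !S_INR; cbn [pow].
    generalize dependent q; intros q.
    generalize dependent (poch (b + 1) i); intros r Hr.
    field; repeat split; lra.
Qed.

Lemma sum_f_R0_vanish (f : nat -> R) (n m : nat) :
  (n <= m)%nat -> (forall j, (n < j)%nat -> f j = 0) -> sum_f_R0 f m = sum_f_R0 f n.
Proof.
  intros H Hf; induction H as [ | m H IH]; cbn [sum_f_R0]; auto.
  rewrite IH, Hf by lia; ring.
Qed.

(** The upper bound [m] is free above the degree because later coefficients vanish; polynomials of
    different degrees can then be summed over one range. *)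
Lemma jacobi_sum (a b z : R) (n m : nat) :
  -1 < a -> -1 < b -> (n <= m)%nat ->
  jacobi a b n (2 * z - 1) = sum_f_R0 (fun j => jac_coef a b n j * z ^ j) m.
Proof.
  intros Ha Hb Hnm.
  transitivity (sum_f_R0 (fun j => jac_coef a b n j * z ^ j) n).
  2: { symmetry; apply sum_f_R0_vanish; auto.
       intros; rewrite jac_coef_vanish by auto; ring. }
  clear m Hnm.
  (* The recurrence reaches back two degrees, so the induction carries two consecutive ones. *)
  cut (jacobi a b n (2 * z - 1) = sum_f_R0 (fun j => jac_coef a b n j * z ^ j) n /\
       jacobi a b (S n) (2 * z - 1) = sum_f_R0 (fun j => jac_coef a b (S n) j * z ^ j) (S n)).
  { tauto. }
  induction n as [ | n [IH0 IH1]].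
  - split; unfold jac_coef; cbn; field; lra.
  - split; [exact IH1 | ].
    change (jacobi a b (S (S n)) (2 * z - 1)) with
      ((jacA a b (INR (S n)) * (2 * z - 1) - jacB a b (INR (S n))) * jacobi a b (S n) (2 * z - 1)
       - jacC a b (INR (S n)) * jacobi a b n (2 * z - 1)).
    rewrite IH0, IH1; clear IH0 IH1.
    rewrite <- (sum_f_R0_vanish (fun j => jac_coef a b n j * z ^ j) n (S (S n)))
      by (try lia; intros; rewrite jac_coef_vanish by auto; ring).
    set (s1 := sum_f_R0 (fun j => jac_coef a b (S n) j * z ^ j) (S n)).
    assert (E : s1 = sum_f_R0 (fun j => jac_coef a b (S n) j * z ^ j) (S (S n))).
    { symmetry; apply sum_f_R0_vanish; [lia | ].
      intros; rewrite jac_coef_vanish by auto; ring. }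
    transitivity (jacA a b (INR (S n)) * (2 * (z * s1))
      - (jacA a b (INR (S n)) + jacB a b (INR (S n))) * s1
      - jacC a b (INR (S n)) * sum_f_R0 (fun j => jac_coef a b n j * z ^ j) (S (S n)));
      [ring | ].
    (* Only the copy of [s1] not multiplied by [z] is extended to [n + 2]. The factor [z] shifts the
       other copy by one degree, so it lines up with the other sums once their constant terms are
       split off. *)
    rewrite E at 2; unfold s1; clear s1 E.
    rewrite !(decomp_sum _ (S (S n))) by lia; cbn [pred].
    rewrite jac_coef_rec_0 by auto; cbn [pow].
    assert (Hsum : forall m,
      sum_f_R0 (fun i => jac_coef a b (S (S n)) (S i) * z ^ S i) m =
      jacA a b (INR (S n)) * (2 * (z * sum_f_R0 (fun j => jac_coef a b (S n) j * z ^ j) m))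
      - (jacA a b (INR (S n)) + jacB a b (INR (S n)))
        * sum_f_R0 (fun i => jac_coef a b (S n) (S i) * z ^ S i) m
      - jacC a b (INR (S n)) * sum_f_R0 (fun i => jac_coef a b n (S i) * z ^ S i) m).
    { induction m as [ | m IH]; cbn [sum_f_R0].
      - rewrite jac_coef_rec_S by auto; cbn [pow]; ring.
      - rewrite IH, jac_coef_rec_S by auto; cbn [pow]; ring. }
    cbn [pow] in Hsum; rewrite Hsum; ring.
Qed.

Lemma jacobi_hat_sum (l a b x : R) (n m : nat) :
  l <> 0 -> -1 < a -> -1 < b -> (n <= m)%nat ->
  jacobi_hat l a b n x = sum_f_R0 (fun j => jac_coef a b n j * (x / l) ^ j) m.
Proof.
  intros Hl Ha Hb Hnm; unfold jacobi_hat.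
  replace (2 * x / l - 1) with (2 * (x / l) - 1) by (field; auto).
  now apply jacobi_sum.
Qed.

Lemma is_derive_sum_f_R0 (f df : nat -> R -> R) (x : R) (n : nat) :
  (forall i, is_derive (f i) x (df i x)) ->
  is_derive (fun t => sum_f_R0 (fun i => f i t) n) x (sum_f_R0 (fun i => df i x) n).
Proof.
  intros H; induction n as [ | n IH]; cbn [sum_f_R0]; auto.
  apply (is_derive_plus (fun t => sum_f_R0 (fun i => f i t) n)); auto.
Qed.

(** Peeling the first factor off the symbols based at [-(n+1)], [n+a+b+2] and [b+1] leaves those of
    degree [n] for [(a+1, b+1)]; the sign of [-(n+1)] is absorbed by [(-1)^(n+1)]. There is no
    factor 1/2 because the variable is [z] and not [2 z - 1]. *)
Lemma jac_coef_deriv (a b : R) (n j : nat) :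
  -1 < b ->
  INR (S j) * jac_coef a b (S n) (S j)
    = (INR n + a + b + 2) * jac_coef (a + 1) (b + 1) n j.
Proof.
  intros Hb; unfold jac_coef.
  rewrite !poch_S_l, !fact_simpl, !mult_INR, !S_INR; cbn [pow].
  replace (- (INR n + 1) + 1) with (- INR n) by ring.
  replace (INR n + 1 + (a + b) + 1 + 1) with (INR n + (a + b) + 3) by ring.
  replace (INR n + (a + 1 + (b + 1)) + 1) with (INR n + (a + b) + 3) by ring.
  assert (Hn := pos_INR n); assert (Hf := INR_fact_lt_0 n).
  assert (Hj := pos_INR j); assert (Hfj := INR_fact_lt_0 j).
  assert (Hp := poch_pos (b + 1 + 1) j ltac:(lra)).
  field; repeat split; lra.
Qed.

Lemma is_derive_jacobi_hat (l a b x : R) (n : nat) :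
  l <> 0 -> -1 < a -> -1 < b ->
  is_derive (jacobi_hat l a b (S n)) x
    ((INR n + a + b + 2) / l * jacobi_hat l (a + 1) (b + 1) n x).
Proof.
  intros Hl Ha Hb.
  apply (is_derive_ext (fun x => sum_f_R0 (fun j => jac_coef a b (S n) j * (x / l) ^ j) (S n))).
  { intros; symmetry; apply jacobi_hat_sum; auto. }
  rewrite (jacobi_hat_sum l (a + 1) (b + 1) x n n) by (auto; lra).
  replace (_ / l * _) with
    (* At [j = 0] the truncated [pred j] is harmless, since the factor [INR j] is zero; that term is
       then dropped and the sum reindexed. *)
    (sum_f_R0 (fun j => jac_coef a b (S n) j * (INR j * (x / l) ^ pred j * / l)) (S n)).
  - apply (is_derive_sum_f_R0 (fun j x => jac_coef a b (S n) j * (x / l) ^ j)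
      (fun j x => jac_coef a b (S n) j * (INR j * (x / l) ^ pred j * / l))).
    intros j; auto_derive; auto; unfold Rdiv; ring.
  - rewrite decomp_sum by lia; cbn [pred]; change (INR 0) with 0.
    rewrite scal_sum, !Rmult_0_l, Rmult_0_r, Rplus_0_l.
    apply sum_eq; intros j _.
    transitivity (INR (S j) * jac_coef a b (S n) (S j) * (x / l) ^ j * / l); [ring | ].
    rewrite jac_coef_deriv by auto; unfold Rdiv; ring.
Qed.

(** * Derivatives of the basis functions *)

Lemma Gamma_poch (s : R) (n : nat) : 0 < s -> Gamma (s + INR n) = poch s n * Gamma s.
Proof.
  intros Hs; induction n as [ | n IH]; cbn [poch].
  - change (INR 0) with 0; rewrite Rplus_0_r; ring.
  - assert (0 <= INR n) by apply pos_INR.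
    rewrite S_INR, <- Rplus_assoc, Gamma_succ, IH by lra; ring.
Qed.

(** The weight [t (l - t)] turns each power [t^j] into [l t^(j+1) - t^(j+2)]. The lowest power is
    therefore [t], which is what lets [is_RL_derive_pow] apply for every [sigma] below 2. *)
Lemma phi_sum (l t : R) (k : nat) :
  l <> 0 ->
  phi l k t = sum_f_R0 (fun j => lam l k * jac_coef 1 1 k j / l ^ j * l * t ^ S j
                               + - (lam l k * jac_coef 1 1 k j / l ^ j) * t ^ S (S j)) k.
Proof.
  intros Hl; unfold phi.
  rewrite (jacobi_hat_sum l 1 1 t k k), scal_sum by (auto; lra).
  apply sum_eq; intros j _.
  assert (l ^ j <> 0) by now apply pow_nonzero.
  unfold Rdiv; rewrite Rpow_mult_distr, pow_inv; cbn [pow]; field; auto.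
Qed.

Definition phi_RL_term (l sigma : R) (k j : nat) (y : R) : R :=
  lam l k * jac_coef 1 1 k j / l ^ j * l
    * (Gamma (INR (S j) + 1) / Gamma (INR (S j) + 1 - sigma) * Rpower y (INR (S j) - sigma))
  + - (lam l k * jac_coef 1 1 k j / l ^ j)
    * (Gamma (INR (S (S j)) + 1) / Gamma (INR (S (S j)) + 1 - sigma)
       * Rpower y (INR (S (S j)) - sigma)).

Lemma is_RL_derive_phi (l sigma : R) (k : nat) :
  l <> 0 -> 0 <= sigma < 2 ->
  is_RL_derive sigma (phi l k) (fun y => sum_f_R0 (fun j => phi_RL_term l sigma k j y) k).
Proof.
  intros Hl Hs.
  apply (is_RL_derive_ext sigma (fun t => sum_f_R0 (fun j =>
    lam l k * jac_coef 1 1 k j / l ^ j * l * t ^ S j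
    + - (lam l k * jac_coef 1 1 k j / l ^ j) * t ^ S (S j)) k)
    _ (fun y => sum_f_R0 (fun j => phi_RL_term l sigma k j y) k)).
  - intros t; symmetry; now apply phi_sum.
  - auto.
  - apply (is_RL_derive_sum sigma (fun j t =>
      lam l k * jac_coef 1 1 k j / l ^ j * l * t ^ S j
      + - (lam l k * jac_coef 1 1 k j / l ^ j) * t ^ S (S j)) (phi_RL_term l sigma k)).
    intros j; unfold phi_RL_term; assert (Hj := pos_INR j).
    apply is_RL_derive_plus; apply is_RL_derive_scal, is_RL_derive_pow; rewrite !S_INR; lra.
Qed.

(** The two sides agree power by power. The image of [t^(j+1)] is the [(1+sigma, 1-sigma)] term, and
    the image of [t^(j+2)] is the sum of the two [(1+sigma, 2-sigma)] terms, whose degrees [k] and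
    [k - 1] give opposite signs. *)
Lemma phi_RL_term_jac_coef (l sigma x : R) (n j : nat) :
  0 < l -> 0 < x -> sigma < 2 ->
  let k := S n in
  phi_RL_term l sigma k j x =
    Rpower x (1 - sigma) *
    ((2 * INR k + 3) * Gamma (INR k + 3) / (l ^ 2 * (INR k + 1) * Gamma (INR k + 2 - sigma))
       * (jac_coef (1 + sigma) (1 - sigma) k j * (x / l) ^ j)
     - (INR k + 2) * Gamma (INR k + 4) / (l ^ 3 * (INR k + 1) * Gamma (INR k + 3 - sigma))
       * x * (jac_coef (1 + sigma) (2 - sigma) k j * (x / l) ^ j)
     - Gamma (INR k + 3) / (l ^ 3 * Gamma (INR k + 2 - sigma))
       * x * (jac_coef (1 + sigma) (2 - sigma) n j * (x / l) ^ j)).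
Proof.
  intros Hl Hx Hs k; unfold phi_RL_term.
  assert (Hk : INR k = INR n + 1) by apply S_INR.
  assert (Hn := pos_INR n); assert (Hj := pos_INR j).
  assert (Hlj : l ^ j <> 0) by (apply pow_nonzero; lra).
  replace (INR (S j) - sigma) with (1 - sigma + INR j) by (rewrite S_INR; ring).
  replace (INR (S (S j)) - sigma) with (1 - sigma + INR j + 1) by (rewrite !S_INR; ring).
  rewrite (Rpower_plus (1 - sigma + INR j)), (Rpower_plus (1 - sigma)), Rpower_1, Rpower_pow
    by auto.
  replace ((x / l) ^ j) with (x ^ j / l ^ j)
    by (unfold Rdiv; now rewrite Rpow_mult_distr, pow_inv).
  set (X := Rpower x (1 - sigma)).
  replace (INR (S j) + 1 - sigma) with (2 - sigma + INR j) by (rewrite S_INR; ring).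
  replace (INR (S (S j)) + 1 - sigma) with (3 - sigma + INR j) by (rewrite !S_INR; ring).
  (* All symbols of length [k] based at [2 - sigma] or [3 - sigma] are brought down to
     [(3-sigma)_n]. *)
  assert (E2 : poch (2 - sigma) k = (2 - sigma) * poch (3 - sigma) n)
    by (unfold k; rewrite poch_S_l; do 2 f_equal; ring).
  assert (E3 : poch (3 - sigma) k = poch (3 - sigma) n * (3 - sigma + INR n)) by reflexivity.
  replace (INR k + 2 - sigma) with (2 - sigma + INR k) by ring.
  replace (INR k + 3 - sigma) with (3 - sigma + INR k) by ring.
  rewrite !Gamma_poch, E2, E3 by lra.
  assert (EG : Gamma (3 - sigma) = (2 - sigma) * Gamma (2 - sigma))
    by (rewrite <- Gamma_succ by lra; f_equal; ring).
  rewrite EG.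
  replace (INR k + 3) with (INR (S (S k)) + 1) by (rewrite !S_INR; ring).
  replace (INR k + 4) with (INR (S (S (S k))) + 1) by (rewrite !S_INR; ring).
  rewrite !INR_fact_Gamma.
  unfold jac_coef.
  replace (1 + 1) with 2 by ring.
  rewrite !poch_2_fact.
  replace (1 - sigma + 1) with (2 - sigma) by ring.
  replace (2 - sigma + 1) with (3 - sigma) by ring.
  rewrite E2, E3.
  replace (INR k + 2 + 1) with (INR k + 3) by ring.
  replace (INR k + (1 + sigma + (1 - sigma)) + 1) with (INR k + 3) by ring.
  replace (INR k + (1 + sigma + (2 - sigma)) + 1) with (INR k + 3 + 1) by ring.
  replace (INR n + (1 + sigma + (2 - sigma)) + 1) with (INR k + 3) by (rewrite Hk; ring).
  (* A symbol of length [j + 1] can be peeled at either end: this expresses [(k+4)_j] through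
     [(k+3)_j], and below [(-(k-1))_j] through [(-k)_j], which produces the factors [k + j + 3] and
     [k - j]. *)
  replace (poch (INR k + 3 + 1) j) with (poch (INR k + 3) j * (INR k + 3 + INR j) / (INR k + 3))
    by (rewrite <- poch_S, poch_S_l; field; lra).
  replace (poch (- INR n) j) with (poch (- INR k) j * (INR k - INR j) / INR k).
  2: { replace (- INR n) with (- INR k + 1) by (rewrite Hk; ring).
       transitivity (- (poch (- INR k) (S j)) / INR k).
       - rewrite poch_S; field; lra.
       - rewrite poch_S_l; field; lra. }
  generalize (poch (- INR k) j) (poch (INR k + 3) j); intros u v.
  assert (Hp2 := poch_pos (2 - sigma) j ltac:(lra)).
  assert (Hp3 := poch_pos (3 - sigma) j ltac:(lra)).
  assert (Hp := poch_pos (3 - sigma) n ltac:(lra)).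
  assert (HG := Gamma_pos (2 - sigma) ltac:(lra)).
  generalize dependent (poch (2 - sigma) j); intros p2 Hp2.
  generalize dependent (poch (3 - sigma) j); intros p3 Hp3.
  clear E2 E3 EG.
  generalize dependent (poch (3 - sigma) n); intros p Hp.
  generalize dependent (Gamma (2 - sigma)); intros G HG.
  unfold k, lam; rewrite !fact_simpl, !mult_INR, !S_INR; cbn [pow].
  assert (HF := INR_fact_lt_0 n); assert (Hf := INR_fact_lt_0 j).
  generalize dependent (INR (fact n)); intros F HF.
  generalize dependent (INR (fact j)); intros f Hf.
  (* Separates the two powers of [x], so that each half is a rational identity of its own. *)
  match goal with |- ?A + ?B = X * (?a - ?b - ?c) =>
    transitivity (X * a + X * (- b - c)); [f_equal | ring]
  end; field; repeat split; lra.
Qed.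

Lemma sum_f_R0_lincomb3 (f g1 g2 g3 : nat -> R) (r c1 c2 c3 : R) (n : nat) :
  (forall j, f j = r * (c1 * g1 j - c2 * g2 j - c3 * g3 j)) ->
  sum_f_R0 f n = r * (c1 * sum_f_R0 g1 n - c2 * sum_f_R0 g2 n - c3 * sum_f_R0 g3 n).
Proof.
  intros H; induction n as [ | n IH]; cbn [sum_f_R0]; rewrite ?IH, H; ring.
Qed.

Lemma jacobi_hat_0 (l a b x : R) : jacobi_hat l a b 0 x = 1.
Proof. reflexivity. Qed.

(** * The ordinary second derivative of the basis functions *)

Lemma is_derive_weighted (l c x df : R) (f : R -> R) :
  is_derive f x df ->
  is_derive (fun x => c * (x * (l - x)) * f x) x
    (c * ((l - 2 * x) * f x + x * (l - x) * df)).
Proof.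
  intros H; auto_derive; [now exists df | ].
  replace (Derive _ x) with df by (symmetry; now apply is_derive_unique); ring.
Qed.

Lemma is_derive_weighted_2 (l c x df ddf : R) (f f1 : R -> R) :
  is_derive f x (f1 x) -> is_derive f1 x ddf ->
  is_derive (fun x => c * ((l - 2 * x) * f x + x * (l - x) * f1 x)) x
    (c * (x * (l - x) * ddf + 2 * (l - 2 * x) * f1 x - 2 * f x)).
Proof.
  intros H H1; auto_derive; [split; [now exists (f1 x) | split; [ now exists ddf | exact I]] | ].
  replace (Derive (fun x => f x) x) with (f1 x) by (symmetry; now apply is_derive_unique).
  replace (Derive (fun x => f1 x) x) with ddf by (symmetry; now apply is_derive_unique).
  ring.
Qed.

Lemma is_RL_derive_2_phi (l : R) (k : nat) (f1 f2 : R -> R) :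
  (forall y, is_derive (jacobi_hat l 1 1 k) y (f1 y)) ->
  (forall y, is_derive f1 y (f2 y)) ->
  is_RL_derive 2 (phi l k)
    (fun x => lam l k * (x * (l - x) * f2 x + 2 * (l - 2 * x) * f1 x
                         - 2 * jacobi_hat l 1 1 k x)).
Proof.
  intros H1 H2.
  apply (is_RL_derive_2 _ (fun x => lam l k * ((l - 2 * x) * jacobi_hat l 1 1 k x
                                              + x * (l - x) * f1 x))).
  - intros y; now apply is_derive_weighted.
  - intros y; now apply is_derive_weighted_2.
Qed.

(** Two applications of the derivative formula give the factors [(k+3)/l] and [(k+4)/l], whence the
    common [1/l^2]. The [match] makes the middle term vanish for [k = 0], where truncated
    subtraction would give a polynomial of degree 0; one statement thus serves every [k]. *)
Lemma is_RL_derive_2_phi_jacobi_hat (l : R) (k : nat) :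
  0 < l ->
  is_RL_derive 2 (phi l k) (fun x =>
    lam l k / l ^ 2 *
      ((INR k + 4) * (INR k + 3) * (x * (l - x)) * jacobi_hat_m2 l 3 3 k x
       + 2 * l * (INR k + 3) * (l - 2 * x)
         * match k with O => 0 | S n => jacobi_hat l 2 2 n x end
       - 2 * l ^ 2 * jacobi_hat l 1 1 k x)).
Proof.
  intros Hl; destruct k as [ | n].
  - eapply is_RL_derive_ext; [reflexivity | | apply (is_RL_derive_2_phi l 0 (fun _ => 0) (fun _ => 0))].
    + intros y _; cbn [jacobi_hat_m2]; field; lra.
    + intros y; apply (is_derive_const (1 : R_NormedModule)).
    + intros y; apply (is_derive_const (0 : R_NormedModule)).
  - assert (H1 : forall y, is_derive (jacobi_hat l 1 1 (S n)) y
      ((INR (S n) + 3) / l * jacobi_hat l 2 2 n y)).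
    { intros y; replace 2 with (1 + 1) by ring.
      replace (INR (S n) + 3) with (INR n + 1 + 1 + 2) by (rewrite S_INR; ring).
      apply is_derive_jacobi_hat; lra. }
    assert (H2 : forall y, is_derive (jacobi_hat l 2 2 n) y
      ((INR (S n) + 4) / l * jacobi_hat_m2 l 3 3 (S n) y)).
    { intros y; destruct n as [ | m].
      (* For [k = 1] the first derivative is constant, in agreement with the value 0 in negative
         degree. *)
      - cbn [jacobi_hat_m2]; rewrite Rmult_0_r.
        apply (is_derive_const (1 : R_NormedModule)).
      - cbn [jacobi_hat_m2]; replace 3 with (2 + 1) by ring.
        replace (INR (S (S m)) + 4) with (INR m + 2 + 2 + 2) by (rewrite !S_INR; ring).
        apply is_derive_jacobi_hat; lra. }
    eapply is_RL_derive_ext; [reflexivity | | apply (is_RL_derive_2_phi l (S n) _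
      (fun y => (INR (S n) + 3) / l * ((INR (S n) + 4) / l * jacobi_hat_m2 l 3 3 (S n) y)) H1)].
    + intros y _; cbv beta iota; field; lra.
    + intros y; now apply (is_derive_scal (jacobi_hat l 2 2 n)).
Qed.

Theorem theorem3 :
  forall l : R, 0 < l ->
  forall x : R, 0 < x < l ->
  (forall sigma : R, (0 < sigma < 1 \/ 1 < sigma < 2) ->
     (forall k : nat, ex_RL_derive sigma (phi l k) x) /\
     psi l sigma 0 x =
       6 * Gamma 2 / (l ^ 2 * Gamma (2 - sigma)) * Rpower x (1 - sigma)
       - 6 * Gamma 3 / (l ^ 3 * Gamma (3 - sigma)) * Rpower x (2 - sigma) /\
     (forall k : nat, (1 <= k)%nat ->
        psi l sigma k x =
          Rpower x (1 - sigma) *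
          ((2 * INR k + 3) * Gamma (INR k + 3)
             / (l ^ 2 * (INR k + 1) * Gamma (INR k + 2 - sigma))
             * jacobi_hat l (1 + sigma) (1 - sigma) k x
           - (INR k + 2) * Gamma (INR k + 4)
             / (l ^ 3 * (INR k + 1) * Gamma (INR k + 3 - sigma))
             * x * jacobi_hat l (1 + sigma) (2 - sigma) k x
           - Gamma (INR k + 3)
             / (l ^ 3 * Gamma (INR k + 2 - sigma))
             * x * jacobi_hat l (1 + sigma) (2 - sigma) (k - 1) x))) /\
  ((forall k : nat, ex_RL_derive 2 (phi l k) x) /\
   psi l 2 0 x = -12 / l ^ 3 /\
   (forall k : nat, (1 <= k)%nat ->
      psi l 2 k x =
        lam l k / l ^ 2 *
        ((INR k + 4) * (INR k + 3) * (x * (l - x)) * jacobi_hat_m2 l 3 3 k x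
         + 2 * l * (INR k + 3) * (l - 2 * x) * jacobi_hat l 2 2 (k - 1) x
         - 2 * l ^ 2 * jacobi_hat l 1 1 k x))).
Proof.
  intros l Hl x [Hx _]; split.
  - intros sigma Hsigma.
    assert (Hs : 0 <= sigma < 2) by lra.
    assert (HRL := fun k => is_RL_derive_correct sigma _ _ x (proj1 Hs) Hx
                     (is_RL_derive_phi l sigma k (Rgt_not_eq _ _ Hl) Hs)).
    split; [ | split].
    + intros k; apply HRL.
    + unfold psi; rewrite (proj2 (HRL O)); cbn [sum_f_R0]; unfold phi_RL_term, jac_coef, lam.
      cbn [poch fact pow INR].
      replace (1 + 1) with 2 by ring; replace (2 + 1) with 3 by ring.
      assert (H2 := Gamma_pos (2 - sigma) ltac:(lra)).
      assert (H3 := Gamma_pos (3 - sigma) ltac:(lra)).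
      field; lra.
    + intros [ | n] Hk; [lia | ].
      unfold psi; rewrite (proj2 (HRL (S n))).
      replace (S n - 1)%nat with n by lia.
      (* All three polynomials are summed up to [k], including the one of degree [k - 1], so that
         the identity can be checked coefficientwise. *)
      rewrite (jacobi_hat_sum l (1 + sigma) (1 - sigma) x (S n) (S n)),
        (jacobi_hat_sum l (1 + sigma) (2 - sigma) x (S n) (S n)),
        (jacobi_hat_sum l (1 + sigma) (2 - sigma) x n (S n)) by (try lia; lra).
      apply sum_f_R0_lincomb3; intros j.
      apply phi_RL_term_jac_coef; lra.
  - assert (HRL := fun k => is_RL_derive_correct 2 _ _ x ltac:(lra) Hx
                     (is_RL_derive_2_phi_jacobi_hat l k Hl)).
    split; [ | split].
    + intros k; apply HRL.
    + unfold psi; rewrite (proj2 (HRL O)); unfold lam.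
      rewrite jacobi_hat_0; cbn [jacobi_hat_m2 INR]; field; lra.
    + intros [ | n] Hk; [lia | ].
      unfold psi; rewrite (proj2 (HRL (S n))).
      replace (S n - 1)%nat with n by lia; reflexivity.
Qed.
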